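(* Let $G=(V,E,J)$ be a countable weighted graph and let $\Lambda \subseteq V$ be finite and non-empty. Then the inequalities \[ \mathbf{P}_\beta\bigl(|K_\mathrm{max}(\Lambda)| \geq \alpha M_\beta(\Lambda)\bigr) \leq \exp\left(-\tfrac{1}{9}\alpha \right) \qquad\text{and}\qquad \mathbf{P}_\beta\bigl(|K_\mathrm{max}(\Lambda)| < \varepsilon M_\beta(\Lambda) \bigr) \leq 27 \varepsilon \] hold for every $\beta\geq 0$, $\alpha \geq 1$, and $0<\varepsilon \leq 1$. Moreover, the inequality \[ \mathbf{P}_\beta\bigl(|K_u \cap \Lambda| \geq \alpha M_\beta(\Lambda)\bigr) \leq e \cdot \mathbf{P}_\beta\bigl(|K_u \cap \Lambda| \geq M_\beta(\Lambda)\bigr) \exp\left(-\tfrac{1}{9}\alpha \right) \] holds for every $\beta \geq 0$, $\alpha \geq 1$, and $u \in V$.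
   Context: A weighted graph $G=(V,E,J)$ is a countable graph $(V,E)$ together with positive weights $\{J_e:e\in E\}$ such that for each $v\in V$ the sum of $J_e$ over edges $e$ incident to $v$ is finite. For $\beta\ge 0$, $\mathbf{P}_\beta$ is the law of Bernoulli-$\beta$ bond percolation on $G$, in which each edge $e$ is retained independently with probability $1-e^{-\beta J_e}$ and otherwise deleted. Clusters are the connected components of the resulting random subgraph; $K_v$ is (the vertex set of) the cluster of $v$. For finite $\Lambda\subseteq V$, $|K_\mathrm{max}(\Lambda)|=\max\{|K_v\cap\Lambda|:v\in V\}$, and $M_\beta(\Lambda)=\min\{n\ge 0:\mathbf{P}_\beta(|K_\mathrm{max}(\Lambda)|\ge n)\le e^{-1}\}$, where $n$ ranges over integers. *)

(* Defs.v *)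
From mathcomp Require Import all_boot all_order all_algebra finmap.
From mathcomp Require Import all_classical all_reals all_analysis.

Set Implicit Arguments.
Unset Strict Implicit.
Unset Printing Implicit Defensive.

Import Order.TTheory GRing.Theory Num.Theory.

Local Open Scope classical_set_scope.
Local Open Scope ring_scope.

(* Loops and parallel edges are allowed; an edge is stored with an arbitrary
   orientation, which no definition below depends on. *)
Record weighted_graph (R : realType) := WeightedGraph {
  vertex : countType;
  edge : countType;
  ends : edge -> vertex * vertex;
  weight : edge -> R;
  weight_gt0 : forall e, 0 < weight e;
  weight_summable : forall v : vertex,
    (\esum_(e in [set e | v = (ends e).1 \/ v = (ends e).2])
       (weight e)%:E < +oo)%E
}.

(* The space {0,1}^E with its product sigma-algebra, which is generated by the
   events "e is retained". *)
Definition edge_retained (R : realType) (G : weighted_graph R) (e : edge G) :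
  set (edge G -> bool) := [set w | w e].

Definition config (R : realType) (G : weighted_graph R) :=
  g_sigma_algebraType (range (@edge_retained R G)).

Definition mutually_independent (d : measure_display) (T : measurableType d)
    (R : realType) (P : probability T R) (I : choiceType) (A : I -> set T) :=
  forall F : {fset I},
    P (\bigcap_(i in [set` F]) A i) = (\prod_(i <- F) P (A i))%E.

(* P_beta is the unique probability on {0,1}^E with this property: the finite
   intersections of the generating events form a pi-system. *)
Definition bernoulli_percolation (R : realType) (G : weighted_graph R)
    (beta : R) (P : probability (config G) R) : Prop :=
  mutually_independent P (@edge_retained R G) /\
  forall e : edge G,
    P (edge_retained e) = (1 - expR (- (beta * weight e)))%:E.

Section clusters.
Context (R : realType) (G : weighted_graph R).
Implicit Types (w : config G) (u v x y : vertex G) (L : {fset vertex G}).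

Definition adjacent w x y : bool :=
  `[< exists e : edge G, w e /\ (ends e = (x, y) \/ ends e = (y, x)) >].

Definition cluster w v : set (vertex G) :=
  [set u | exists p : seq (vertex G), path (adjacent w) v p /\ last v p = u].

Definition cluster_size L w v : nat := #|` [fset u in L | u \in cluster w v]%fset|.

End clusters.

(* The maximum and the minimum of a set of naturals, 0 when there is none. *)
Definition nat_max (A : set nat) : nat := xget 0%N (A `&` ubound A).
Definition nat_min (A : set nat) : nat := xget 0%N (A `&` lbound A).

Definition Kmax (R : realType) (G : weighted_graph R)
    (L : {fset vertex G}) (w : config G) : nat :=
  nat_max (range (cluster_size L w)).

Definition typical_max (R : realType) (G : weighted_graph R)
    (P : probability (config G) R) (L : {fset vertex G}) : nat :=
  nat_min [set n : nat |
    (P [set w : config G | (n <= Kmax L w)%N] <= (expR (-1))%:E)%E].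

(* The extrema used in Kmax and typical_max are attained, so that the default
   value 0 is never used. *)
Lemma nat_minP (A : set nat) : A !=set0 -> (A `&` lbound A) (nat_min A).
Proof.
move=> [n An].
have exA : exists n, (fun m => `[< A m >]) n by exists n; apply/asboolP.
case: (ex_minnP exA) => m /asboolP Am mle.
rewrite /nat_min; apply: (xgetPex 0%N (P := A `&` lbound A)).
by exists m; split=> // k Ak; apply: mle; apply/asboolP.
Qed.

Lemma nat_maxP (A : set nat) (b : nat) :
  A !=set0 -> ubound A b -> (A `&` ubound A) (nat_max A).
Proof.
move=> [n An] Ab.
have exA : exists n, (fun m => `[< A m >]) n by exists n; apply/asboolP.
have leb m : `[< A m >] -> (m <= b)%N by move=> /asboolP /Ab.
case: (ex_maxnP exA leb) => m /asboolP Am lem.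
rewrite /nat_max; apply: (xgetPex 0%N (P := A `&` ubound A)).
by exists m; split=> // k Ak; apply: lem; apply/asboolP.
Qed.

Section attained.
Context (R : realType) (G : weighted_graph R).
Implicit Types (w : config G) (L : {fset vertex G}).

Lemma cluster_size_le L w v : (cluster_size L w v <= #|` L|)%N.
Proof.
by apply: fsubset_leq_card; apply/fsubsetP => u; rewrite !inE => /andP[].
Qed.

Lemma KmaxP L w : L != fset0%fset ->
  (exists v, cluster_size L w v = Kmax L w) /\
  (forall v, (cluster_size L w v <= Kmax L w)%N).
Proof.
move=> /fset0Pn[v0 _].
have [||[v _ vE] leK] := @nat_maxP (range (cluster_size L w)) #|` L|.
- by exists (cluster_size L w v0), v0.
- by move=> _ [v _ <-]; apply: cluster_size_le.
by split=> [|u]; [exists v | apply: leK; exists u].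
Qed.

Lemma typical_maxP (P : probability (config G) R) L : L != fset0%fset ->
  let small n :=
    (P [set w : config G | (n <= Kmax L w)%N] <= (expR (-1))%:E)%E in
  small (typical_max P L) /\ (forall n, small n -> (typical_max P L <= n)%N).
Proof.
move=> L0 small.
have [|Hs Hm] := @nat_minP [set n | small n]; last by split.
exists #|` L|.+1; rewrite /= /small.
suff -> : [set w : config G | (#|` L| < Kmax L w)%N] = set0.
  by rewrite measure0 lee_fin expR_ge0.
apply/seteqP; split=> w //= ; apply/negP; rewrite -leqNgt.
by have [[v <-] _] := KmaxP w L0; apply: cluster_size_le.
Qed.

End attained.

(* Main.v *)
Require Import Defs.
From mathcomp Require Import all_boot all_order all_algebra finmap.
From mathcomp Require Import all_classical all_reals all_analysis.
From mathcomp Require Import zify lra.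

(* A spanning tree of a cluster that contains at least (2k+1)m points of L can be
   cut into k+1 edge-disjoint connected pieces with at least m points of L each,
   the last one containing a prescribed vertex of the cluster: repeatedly cut off
   a minimal subtree that reaches m points, which costs at most 2m points. Hence
   the BK inequality gives P(N <= Kmax) <= P(m <= Kmax)^(k+1) and
   P(N <= |K_u|) <= P(m <= Kmax)^k P(m <= |K_u|) for N >= (2k+1)m. For m = M this
   yields the upper tails, since P(M <= Kmax) <= 1/e. For N = M - 1 the left side
   exceeds 1/e, so that P(m <= Kmax) is at least e^(-1/(k+1)) with k of order
   M/(2m), which yields the lower tail. *)

Set Implicit Arguments.
Unset Strict Implicit.
Unset Printing Implicit Defensive.

Import Order.TTheory GRing.Theory Num.Theory.

Local Open Scope classical_set_scope.
Local Open Scope ring_scope.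

(* MathComp-Analysis also has a [cluster] and an [adjacent]. *)
Local Notation cluster := Defs.cluster.
Local Notation adjacent := Defs.adjacent.

(** * Disjoint occurrence and the BK inequality on finitely many edges *)

Section van_den_berg_kesten.
Context (R : realType) (E : choiceType).
Implicit Types (w : E -> bool) (A B : set (E -> bool)) (es : seq E).

Definition up_closed A := forall w w', (forall e, w e -> w' e) -> A w -> A w'.

(** For increasing events this is the usual $A \circ B$: a witness is then just a set of open edges,
    encoded as a smaller configuration. *)
Definition disjoint_occurrence A B : set (E -> bool) :=
  [set w | exists w1 w2, [/\ forall e, w1 e -> w e, forall e, w2 e -> w e,
     forall e, ~~ (w1 e && w2 e), A w1 & B w2]].

Definition add_edge e w : E -> bool := fun x => (x == e) || w x.

Lemma up_closed_disjoint_occurrence A B : up_closed (disjoint_occurrence A B).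
Proof.
move=> w w' ww' [w1 [w2 [h1 h2 d a b]]]; exists w1, w2; split=> // e.
  by move/h1/ww'.
by move/h2/ww'.
Qed.

Lemma up_closed_add_edge e A : up_closed A -> up_closed (add_edge e @^-1` A).
Proof.
move=> uA w w' ww'; apply: uA => x /orP[xe|/ww' w'x]; rewrite /add_edge.
  by rewrite xe.
by rewrite w'x orbT.
Qed.

Lemma sub_add_edge e A : up_closed A -> A `<=` add_edge e @^-1` A.
Proof. by move=> uA w; apply: uA => x wx; rewrite /add_edge wx orbT. Qed.

Lemma disjoint_occurrenceS A A' B B' : A `<=` A' -> B `<=` B' ->
  disjoint_occurrence A B `<=` disjoint_occurrence A' B'.
Proof.
move=> AA BB w [w1 [w2 [h1 h2 d a b]]].
by exists w1, w2; split=> //; [exact: AA|exact: BB].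
Qed.

(** At most one of the two disjoint witnesses uses [e]; once [e] is removed from it, both are open
    in [w] itself. *)
Lemma add_edge_disjoint_occurrence e A B : up_closed B ->
  add_edge e @^-1` disjoint_occurrence A B `<=`
    disjoint_occurrence A (add_edge e @^-1` B) `|`
    disjoint_occurrence (add_edge e @^-1` A) B.
Proof.
move=> uB w [w1 [w2 [h1 h2 d a b]]].
have strip w' : (forall x, w' x -> add_edge e w x) ->
    forall x, w' x && (x != e) -> w x.
  by move=> h x /andP[/h]; rewrite /add_edge => /orP[->|].
have fill w' : w' e -> add_edge e (fun x => w' x && (x != e)) = w'.
  by move=> w'e; apply/funext => x; rewrite /add_edge; case: eqVneq => [->|];
    rewrite /= ?w'e // andbT.
have out w' : ~~ w' e -> (forall x, w' x -> add_edge e w x) ->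
    forall x, w' x -> w x.
  move=> w'e h x w'x; apply: (strip _ h); rewrite w'x /=.
  by apply: contraNneq w'e => <-.
have [w1e|w1e] := boolP (w1 e).
- right; exists (fun x => w1 x && (x != e)), w2; split=> //.
  + exact: strip.
  + by apply: out => //; have := d e; rewrite w1e.
  + by move=> x; apply: contra (d x) => /andP[/andP[-> _] ->].
  + by rewrite /preimage /= fill.
- left; exists w1, (fun x => w2 x && (x != e)); split=> //.
  + exact: out.
  + exact: strip.
  + by move=> x; apply: contra (d x) => /andP[-> /andP[-> _]].
  (* [w2] need not use [e], so restoring [e] may enlarge it; monotonicity of [B] absorbs this. *)
  + rewrite /preimage /=; apply: uB b => x w2x; rewrite /add_edge.
    by rewrite w2x /= orbN.
Qed.

Variable p : E -> R.
Hypothesis p01 : forall e, 0 <= p e <= 1.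

(* The probability of [A] when the edges of [es] are open independently with
   probability [p] and all other edges are closed. *)
Fixpoint finite_prob es A : R :=
  if es is e :: es' then
    (1 - p e) * finite_prob es' A + p e * finite_prob es' (add_edge e @^-1` A)
  else (`[< A (fun=> false) >])%:R.

Lemma finite_prob_ge0 es A : 0 <= finite_prob es A.
Proof.
elim: es A => [|e es IH] A /=; first by case: asboolP.
by have /andP[p0 p1] := p01 e; rewrite addr_ge0 // mulr_ge0 // subr_ge0.
Qed.

Lemma le_finite_prob es A B : A `<=` B -> finite_prob es A <= finite_prob es B.
Proof.
elim: es A B => [|e es IH] A B AB /=.
  by rewrite ler_nat; case: asboolP => // /AB ?; rewrite asboolT.
have /andP[p0 p1] := p01 e.
by rewrite lerD // ler_wpM2l ?subr_ge0 // IH // => w; exact: AB.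
Qed.

Lemma finite_probUI es A B :
  finite_prob es (A `|` B) + finite_prob es (A `&` B) =
  finite_prob es A + finite_prob es B.
Proof.
elim: es A B => [|e es IH] A B /=.
  rewrite -!natrD; congr (_%:R).
  by rewrite asbool_or asbool_and; case: asboolP; case: asboolP.
have IH0 := IH A B; have IH1 := IH (add_edge e @^-1` A) (add_edge e @^-1` B).
rewrite preimage_setU preimage_setI; nra.
Qed.

(** Condition on the first edge [e]. The induction hypothesis is applied with [e] added in neither,
    both or exactly one of the events; the two mixed cases enter only through their sum. *)
Lemma van_den_berg_kesten es A B : up_closed A -> up_closed B ->
  finite_prob es (disjoint_occurrence A B) <=
  finite_prob es A * finite_prob es B.
Proof.
elim: es A B => [|e es IH] A B uA uB /=.
  rewrite -natrM ler_nat; case: asboolP => // -[w1 [w2 [h1 h2 _ a b]]].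
  by rewrite !asboolT //; [apply: uB b | apply: uA a].
have uA1 := up_closed_add_edge (e := e) uA.
have uB1 := up_closed_add_edge (e := e) uB.
have sA := sub_add_edge e uA; have sB := sub_add_edge e uB.
set A1 := add_edge e @^-1` A in uA1 sA *.
set B1 := add_edge e @^-1` B in uB1 sB *.
set D1 := _ @^-1` disjoint_occurrence A B.
have D1sub : D1 `<=` disjoint_occurrence A B1 `|` disjoint_occurrence A1 B.
  exact: add_edge_disjoint_occurrence.
have le0 := IH _ _ uA uB.
have le1 : finite_prob es D1 <= finite_prob es A1 * finite_prob es B1.
  apply: le_trans (IH _ _ uA1 uB1); apply: le_finite_prob => w /D1sub.
  by case; apply: disjoint_occurrenceS => //; exact: subset_refl.
(* The union of the two mixed disjoint occurrences contains [D1] and their intersection contains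
   that of [A] and [B], so inclusion-exclusion bounds the sum. *)
have le01 : finite_prob es (disjoint_occurrence A B) + finite_prob es D1 <=
    finite_prob es A * finite_prob es B1 + finite_prob es A1 * finite_prob es B.
  apply: le_trans (lerD (IH _ _ uA uB1) (IH _ _ uA1 uB)).
  rewrite -[leRHS]finite_probUI addrC lerD //; apply: le_finite_prob => //.
  rewrite subsetI; split; exact: disjoint_occurrenceS.
have a01 := le_finite_prob es sA; have b01 := le_finite_prob es sB.
have /andP[p0 p1] := p01 e.
move: le0 le1 le01 a01 b01 p0 p1.
move: (finite_prob _ _) (finite_prob _ D1) (finite_prob _ A) (finite_prob _ B)
  (finite_prob _ A1) (finite_prob _ B1) (p e) => x y a b a' b' q.
move=> le0 le1 le01 a01 b01 q0 q1.
(* With [x = P(A o B)], [y = P((A o B)_1)], [a' = P(A_1)], [b' = P(B_1)] the claim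
   follows from [x <= a b], [y <= a' b'] and [x + y <= a b' + a' b]: eliminate [y]
   by the third bound if [q <= 1/2], and [x] otherwise; the slack is a square
   times [(a' - a) (b' - b)]. *)
have cross : 0 <= (a' - a) * (b' - b) by rewrite mulr_ge0 ?subr_ge0.
have [q2|q2] := leP q (1 / 2).
- have h1 : q * (x + y) <= q * (a * b' + a' * b) by rewrite ler_wpM2l.
  have h2 : (1 - 2 * q) * x <= (1 - 2 * q) * (a * b).
    by rewrite ler_wpM2l //; lra.
  have h3 : 0 <= q * q * ((a' - a) * (b' - b)) by rewrite mulr_ge0 // mulr_ge0.
  nra.
- have h1 : (1 - q) * (x + y) <= (1 - q) * (a * b' + a' * b).
    by rewrite ler_wpM2l //; lra.
  have h2 : (2 * q - 1) * y <= (2 * q - 1) * (a' * b').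
    by rewrite ler_wpM2l //; lra.
  have h3 : 0 <= (1 - q) * (1 - q) * ((a' - a) * (b' - b)).
    by rewrite mulr_ge0 // mulr_ge0; lra.
  nra.
Qed.

End van_den_berg_kesten.

(** * Finite trees inside clusters, and cutting them *)

Section trees.
Context (R : realType) (G : weighted_graph R).
Implicit Types (u v x y : vertex G) (e : edge G) (F : {fset edge G}).
Implicit Types (S L : {fset vertex G}) (w : config G).
Local Open Scope fset_scope.

Definition joins e x y := ends e = (x, y) \/ ends e = (y, x).

(* The vertex sets of the two parts of a graft may overlap: only edge-disjointness
   is needed. *)
Inductive rooted_tree : vertex G -> {fset edge G} -> {fset vertex G} -> Prop :=
| Single u : rooted_tree u fset0 [fset u]
| Graft u v e F1 F2 S1 S2 : joins e u v -> e \notin F1 -> e \notin F2 ->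
    [disjoint F1 & F2] -> rooted_tree u F1 S1 -> rooted_tree v F2 S2 ->
    rooted_tree u (e |` (F1 `|` F2)) (S1 `|` S2).

Definition config_of F : config G := fun e => e \in F.

Lemma cluster_mono w w' u : (forall e, w e -> w' e) ->
  (cluster w u `<=` cluster w' u)%classic.
Proof.
move=> ww' x [s [ps lx]]; exists s; split=> //; apply: sub_path ps => y z.
by move=> /asboolP[e [we h]]; apply/asboolP; exists e; split=> //; exact: ww'.
Qed.

Lemma cluster_refl w u : cluster w u u. Proof. by exists [::]. Qed.

Lemma cluster_step w u v x e : w e -> joins e u v -> cluster w v x ->
  cluster w u x.
Proof.
move=> we h [s [ps lx]]; exists (v :: s); split=> //=; rewrite ps andbT.
by apply/asboolP; exists e.
Qed.

Lemma rooted_tree_root u F S : rooted_tree u F S -> u \in S.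
Proof.
elim=> [v|v1 v2 e F1 F2 S1 S2 _ _ _ _ _ h _ _]; first by rewrite in_fset1.
by rewrite in_fsetU h.
Qed.

Lemma rooted_tree_cluster u F S x : rooted_tree u F S -> x \in S ->
  cluster (config_of F) u x.
Proof.
move=> T; elim: T x => {u F S}
  [u|u v e F1 F2 S1 S2 uev _ _ _ T1 IH1 T2 IH2] x.
  by rewrite in_fset1 => /eqP ->; exact: cluster_refl.
rewrite in_fsetU => /orP[/IH1|/IH2] h.
  by apply: cluster_mono h => f; rewrite /config_of !inE => ->; rewrite orbT.
apply: (@cluster_step _ _ v x e) => //; first by rewrite /config_of !inE eqxx.
by apply: cluster_mono h => f; rewrite /config_of !inE => ->; rewrite !orbT.
Qed.

Lemma rooted_tree_ends u F S e x y : rooted_tree u F S -> e \in F ->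
  joins e x y -> y \in S.
Proof.
move=> T; elim: T => {u F S} [u|u v f F1 F2 S1 S2 ufv _ _ _ T1 IH1 T2 IH2] //.
rewrite !inE => /or3P[/eqP ->|/IH1 h|/IH2 h] exy.
- have := rooted_tree_root T1; have := rooted_tree_root T2.
  move=> vS uS; case: ufv => uf; case: exy; rewrite uf => -[? ?]; subst;
    by rewrite ?uS ?vS ?orbT.
- by rewrite h.
- by rewrite h ?orbT.
Qed.

(** The edge is pushed down into a part of each graft that contains [x], until the single vertex [x]
    is reached, where it grafts two single vertices. *)
Lemma rooted_tree_leaf u F S x y e : rooted_tree u F S -> x \in S ->
  joins e x y -> e \notin F -> rooted_tree u (e |` F) (y |` S).
Proof.
move=> T xS exy; elim: T xS => {u F S}
  [u|u v f F1 F2 S1 S2 ufv f1 f2 d T1 IH1 T2 IH2].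
  rewrite inE => /eqP <- _.
  suff -> : e |` fset0 = e |` (fset0 `|` fset0) :> {fset edge G}.
    rewrite [_ |` [fset _]]fsetUC; apply: (@Graft _ y) => //; try exact: Single.
    by rewrite fdisjoint0X.
  by rewrite !fsetU0.
rewrite !inE !negb_or => xS /and3P[ef e1 e2].
case/orP: xS => xS.
- have -> : e |` (f |` (F1 `|` F2)) = f |` ((e |` F1) `|` F2).
    by rewrite fsetUCA -[(e |` F1) `|` F2]fsetUA.
  rewrite [y |` _]fsetUA; apply: (Graft ufv) => //; last exact: IH1.
    by rewrite !inE negb_or f1 eq_sym ef.
  by rewrite fdisjointU1X e2.
- have -> : e |` (f |` (F1 `|` F2)) = f |` (F1 `|` (e |` F2)).
    by rewrite [F1 `|` (_ |` _)]fsetUCA fsetUCA.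
  rewrite [y |` _]fsetUCA; apply: (Graft ufv) => //; last exact: IH2.
    by rewrite !inE negb_or f2 eq_sym ef.
  by rewrite fdisjoint_sym fdisjointU1X e1 fdisjoint_sym.
Qed.

(** Walk along the path: both ends of a tree edge lie in [S], so a step that leaves [S] uses a new
    edge, which is attached as a leaf. *)
Lemma rooted_tree_extend w u F S x s : rooted_tree u F S ->
  (forall e, e \in F -> w e) -> x \in S -> path (adjacent w) x s ->
  exists F' S', [/\ rooted_tree u F' S', forall e, e \in F' -> w e,
    S `<=` S' & last x s \in S'].
Proof.
elim: s x F S => [|y s IH] x F S T Fw xS /=; first by exists F, S.
move=> /andP[/asboolP[e [we exy]] ps].
have [yS|yS] := boolP (y \in S); first exact: (IH _ F S).
have eF : e \notin F.
  by apply: contra yS => eF; exact: rooted_tree_ends T eF exy.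
have [||F' [S' [T' Fw' SS' lS]]] :=
  IH y _ _ (rooted_tree_leaf T xS exy eF) _ _ ps.
- by move=> f; rewrite !inE => /orP[/eqP ->|/Fw].
- by rewrite !inE eqxx.
exists F', S'; split=> //; apply: fsubset_trans SS'; exact: fsubsetU1.
Qed.

(** The points of [S] are joined to the tree one by one along open paths from the root; the tree
    stays finite even if the cluster is infinite. *)
Lemma cluster_rooted_tree w u S : (forall x, x \in S -> cluster w u x) ->
  exists F S', [/\ rooted_tree u F S', forall e, e \in F -> w e & S `<=` S'].
Proof.
elim/finSet_rect: S => S IH Su.
have [->|[x xS]] := fset_0Vmem S.
  by exists fset0, [fset u]; split=> //; exact: Single.
have [||F [S' [T Fw SS']]] := IH (S `\ x).
- exact: fproperD1.
- by move=> y; rewrite !inE => /andP[_ /Su].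
have [s [ps lx]] := Su _ xS.
have [F' [S'' [T' Fw' SS'' lS]]] :=
  rooted_tree_extend T Fw (rooted_tree_root T) ps.
exists F', S''; split=> //; rewrite -(fsetD1K xS) fsubUset fsub1set -{1}lx lS.
exact: fsubset_trans SS''.
Qed.

(* Cut off the first subtree that reaches [m] points of [L] while both of its
   grafted parts have fewer. *)
Lemma rooted_tree_peel L m u F S : rooted_tree u F S -> (m <= #|` S `&` L|)%N ->
  exists v F1 S1 F2 S2, [/\ rooted_tree v F1 S1, rooted_tree u F2 S2,
    F1 `<=` F, F2 `<=` F & [/\ [disjoint F1 & F2], (m <= #|` S1 `&` L|)%N,
    S2 `<=` S & (#|` (S `\` S2) `&` L| <= 2 * m)%N]].
Proof.
elim=> {u F S} [u|u v e F1 F2 S1 S2 uev e1 e2 d T1 IH1 T2 IH2] mS.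
  (* The single vertex is both cut off and kept, so no point is lost. *)
  exists u, fset0, [fset u], fset0, [fset u]; split=> //; try exact: Single.
  by split; rewrite ?fdisjoint0X ?fsetDv ?fset0I ?cardfs0.
have [m1|m1] := leqP m #|` S1 `&` L|.
  have [x [F3 [S3 [F4 [S4 [T3 T4 F31 F41 [d34 m3 S41 c]]]]]]] := IH1 m1.
  exists x, F3, S3, (e |` (F4 `|` F2)), (S4 `|` S2); split=> //.
  - apply: (Graft uev) => //; first by apply: contra e1; exact/fsubsetP.
    exact: fdisjointWl d.
  - apply: fsubset_trans F31 _; rewrite fsetUCA fsubsetUl //.
  - by rewrite fsetUS // fsetSU.
  - split=> //.
    + rewrite !fdisjointXU d34 (fdisjointWl F31 d) /= andbT.
      rewrite fdisjoint_sym fdisjoint1X; apply: contra e1; exact/fsubsetP.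
    + exact: fsetSU.
    + apply: leq_trans c; apply: fsubset_leq_card; apply/fsubsetP => y.
      by rewrite !inE; do 4 case: (_ \in _).
have [m2|m2] := leqP m #|` S2 `&` L|.
  have [x [F3 [S3 [F4 [S4 [T3 T4 F31 F41 [d34 m3 S41 c]]]]]]] := IH2 m2.
  exists x, F3, S3, (e |` (F1 `|` F4)), (S1 `|` S4); split=> //.
  - apply: (Graft uev) => //; first by apply: contra e2; exact/fsubsetP.
    exact: fdisjointWr d.
  - apply: fsubset_trans F31 _; rewrite fsetUA fsubsetUr //.
  - by rewrite fsetUS // fsetUS.
  - split=> //.
    + rewrite !fdisjointXU d34 andbT fdisjoint_sym fdisjoint1X.
      rewrite [X in _ && X]fdisjoint_sym (fdisjointWr F31 d) andbT.
      by apply: contra e2; exact/fsubsetP.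
    + exact: fsetUS.
    + apply: leq_trans c; apply: fsubset_leq_card; apply/fsubsetP => y.
      by rewrite !inE; do 4 case: (_ \in _).
(* Neither part reaches [m]: the whole tree is cut off, only its root is kept, and fewer than
   [2 * m] points of [L] are lost. *)
exists u, (e |` (F1 `|` F2)), (S1 `|` S2), fset0, [fset u]; split=> //.
- by apply: (Graft uev).
- exact: Single.
- split=> //.
  + by rewrite fdisjointX0.
  + by rewrite fsub1set inE (rooted_tree_root T1).
  + apply: (@leq_trans #|` (S1 `|` S2) `&` L|).
      by apply: fsubset_leq_card; rewrite fsetSI // fsubsetDl.
    rewrite fsetIUl; have := cardfsUI (S1 `&` L) (S2 `&` L); lia.
Qed.

End trees.

(** * From finite sets of edges to the percolation measure *)

Section independent_edges.
Context (R : realType) (G : weighted_graph R) (P : probability (config G) R).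
Hypothesis indep : mutually_independent P (@edge_retained R G).
Implicit Types (e : edge G) (es : seq (edge G)) (F : {fset edge G}).
Implicit Types (w : config G) (A B C : set (edge G -> bool)).

Let p e : R := fine (P (edge_retained e)).

Definition restrict es w : config G := fun e => w e && (e \in es).

Lemma measurable_edge_retained e :
  measurable (edge_retained e : set (config G)).
Proof. by apply: sub_sigma_algebra; exists e. Qed.

Lemma edge_probability_itv e : 0 <= p e <= 1.
Proof.
have me := measurable_edge_retained e.
by rewrite /p fine_ge0 //= -lee_fin fineK ?fin_num_measure // probability_le1.
Qed.

Lemma restrict_nil A : [set w | A (restrict [::] w)] =
  if `[< A (fun=> false) >] then setT else set0.
Proof.
have r0 w : restrict [::] w = (fun=> false).
  by apply/funext => e; rewrite /restrict andbF.
by case: asboolP => a; apply/seteqP; split=> w //=; rewrite r0.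
Qed.

(** Splitting on the state of [e] mirrors the recursion of [finite_prob]. *)
Lemma restrict_cons e es A : [set w | A (restrict (e :: es) w)] =
  (edge_retained e `&` [set w | (add_edge e @^-1` A) (restrict es w)]) `|`
  (~` edge_retained e `&` [set w | A (restrict es w)]).
Proof.
have r w : restrict (e :: es) w =
    if w e then add_edge e (restrict es w) else restrict es w.
  case: ifPn => we; apply/funext => x; rewrite /restrict /add_edge inE andb_orr.
    by congr orb; case: eqVneq => [->|]; rewrite ?we ?andbF.
  by case: eqVneq => [->|]; rewrite ?andbF // (negbTE we).
apply/seteqP; split=> w /=; rewrite r /edge_retained /=.
  by case: ifPn => we; [left|right; split=> //; exact/negP].
by case=> -[we]; rewrite ?we // (negbTE (introN idP we)).
Qed.

Lemma measurable_restrict es A : measurable [set w | A (restrict es w)].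
Proof.
elim: es A => [|e es IH] A; first by rewrite restrict_nil; case: ifP.
rewrite restrict_cons; have me := measurable_edge_retained e.
by apply: measurableU; apply: measurableI => //; exact: measurableC.
Qed.

Lemma probability_all_retained F :
  P (\bigcap_(e in [set` F]) edge_retained e) = (\prod_(e <- F) p e)%:E.
Proof.
rewrite indep -prodEFin; apply: eq_bigr => e _.
by rewrite fineK // fin_num_measure //; exact: measurable_edge_retained.
Qed.

(* The open edges [F] are those already revealed in the induction on [es]. *)
Lemma probability_restrict_open es F A : uniq es ->
  (forall e, e \in es -> e \notin F) ->
  P (\bigcap_(e in [set` F]) edge_retained e `&` [set w | A (restrict es w)]) =
  (\prod_(e <- F) p e * finite_prob p es A)%:E.
Proof.
have mF F' :
    measurable (\bigcap_(e in [set` F']) (edge_retained e : set (config G))).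
  apply: fin_bigcap_measurable => [|e _]; first exact: finite_fset.
  exact: measurable_edge_retained.
elim: es F A => [|e es IH] F A.
  rewrite restrict_nil /= => _ _; case: asboolP => _.
    by rewrite setIT mulr1 probability_all_retained.
  by rewrite setI0 measure0 mulr0.
move=> /= /andP[ees ues] esF.
have eF : e \notin F by apply: esF; rewrite inE eqxx.
have esF' x : x \in es -> x \notin F.
  by move=> xs; apply: esF; rewrite inE xs orbT.
have me := measurable_edge_retained e.
have mr B := measurable_restrict es B.
(* Requiring [e] to be open moves it into [F], where the induction hypothesis applies. *)
have key B : P ((\bigcap_(x in [set` F]) edge_retained x `&`
    [set w | B (restrict es w)]) `&` edge_retained e) =
    (p e * (\prod_(x <- F) p x) * finite_prob p es B)%:E.
  have -> : (\bigcap_(x in [set` F]) edge_retained x `&`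
      [set w | B (restrict es w)]) `&` edge_retained e =
      \bigcap_(x in [set` (e |` F)%fset]) edge_retained x `&`
      [set w | B (restrict es w)].
    apply/seteqP; split=> w /=.
      move=> [[wF Bw] we]; split=> // x /=; rewrite !inE => /orP[/eqP -> //|].
      exact: wF.
    move=> [wF Bw]; split; last by apply: wF; rewrite /= !inE eqxx.
    by split=> // x /= xF; apply: wF; rewrite /= !inE xF orbT.
  rewrite IH ?big_fsetU1 // => x xs; rewrite !inE negb_or esF' // andbT.
  by apply: contraNneq ees => <-.
have mX B := measurableI _ _ (mF F) (mr B).
have mXD B := measurableD (mX B) me.
(* Independence speaks of open edges only, so the case of closed [e] is obtained by subtraction. *)
have split B : fine (P ((\bigcap_(x in [set` F]) edge_retained x `&`
    [set w | B (restrict es w)]) `\` edge_retained e)) =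
    (1 - p e) * (\prod_(x <- F) p x * finite_prob p es B).
  have : P (\bigcap_(x in [set` F]) edge_retained x `&`
      [set w | B (restrict es w)]) =
    (P ((\bigcap_(x in [set` F]) edge_retained x `&`
        [set w | B (restrict es w)]) `\` edge_retained e) +
     P ((\bigcap_(x in [set` F]) edge_retained x `&`
        [set w | B (restrict es w)]) `&` edge_retained e))%E.
    exact: measureDI.
  rewrite key IH // -[X in (X + _)%E]fineK; last exact: fin_num_measure.
  by rewrite -EFinD => -[h]; lra.
rewrite restrict_cons setIUr.
rewrite [edge_retained e `&` _]setIC setIA.
rewrite [~` edge_retained e `&` _]setIC setIA -setDE.
set X1 := _ `&` edge_retained e; set X0 := _ `\` edge_retained e.
have -> : P (X1 `|` X0) = (P X1 + P X0)%E.
  apply: measureU; [exact: measurableI|exact: mXD|].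
  by apply/seteqP; split=> w //= [[_ we] [_ nwe]]; exact: nwe.
rewrite key -[P X0]fineK ?fin_num_measure //; last exact: mXD.
rewrite split -EFinD; congr EFin; lra.
Qed.

Lemma probability_restrict es A : uniq es ->
  P [set w | A (restrict es w)] = (finite_prob p es A)%:E.
Proof.
move=> ues; have := @probability_restrict_open es fset0 A ues.
by rewrite big_seq_fset0 mul1r set_fset0 bigcap_set0 setTI => ->.
Qed.

(** Together with [up_closed], this makes [A] an increasing union of events that depend on finitely
    many edges, hence measurable. *)
Definition finitely_witnessed A :=
  forall w, A w -> exists2 F, (forall e, e \in F -> w e) & A (config_of F).

(** Finite windows that exhaust the edges. Different codes may decode to the same edge; [undup]
    provides the [uniq] that [probability_restrict] asks for. *)
Definition edges_upto n : seq (edge G) :=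
  undup (pmap choice.unpickle (iota 0 n)).

Lemma mem_edges_upto n e : (choice.pickle e < n)%N -> e \in edges_upto n.
Proof.
move=> en; rewrite mem_undup mem_pmap; apply/mapP; exists (choice.pickle e).
  by rewrite mem_iota.
by rewrite choice.pickleK.
Qed.

Lemma sub_edges_upto m n : (m <= n)%N -> {subset edges_upto m <= edges_upto n}.
Proof.
move=> mn e; rewrite !mem_undup !mem_pmap => /mapP[i im ->]; apply: map_f.
by move: im; rewrite !mem_iota /= !add0n => /leq_trans; exact.
Qed.

Lemma fset_sub_edges_upto F : exists n, {subset F <= edges_upto n}.
Proof.
exists (\max_(e <- F) (choice.pickle e).+1)%N => e eF; apply: mem_edges_upto.
exact: (@leq_bigmax_seq _ _ xpredT (fun e : edge G => (choice.pickle e).+1)).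
Qed.

Lemma up_closed_bigcup_restrict A : up_closed A -> finitely_witnessed A ->
  A = \bigcup_n [set w | A (restrict (edges_upto n) w)].
Proof.
move=> uA fA; apply/seteqP; split=> w.
  move=> /fA[F Fw AF]; have [n Fn] := fset_sub_edges_upto F.
  exists n => //=; apply: uA AF => e eF.
  by rewrite /restrict (Fw _ eF) (Fn _ eF).
by move=> [n _]; apply: uA => e /andP[].
Qed.

Lemma measurable_finitely_witnessed A : up_closed A -> finitely_witnessed A ->
  measurable (A : set (config G)).
Proof.
move=> uA fA; rewrite (up_closed_bigcup_restrict uA fA).
by apply: bigcup_measurable => n _; exact: measurable_restrict.
Qed.

Lemma finite_prob_le A n : up_closed A -> finitely_witnessed A ->
  finite_prob p (edges_upto n) A <= fine (P A).
Proof.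
move=> uA fA; have mA := measurable_finitely_witnessed uA fA.
rewrite -lee_fin fineK ?fin_num_measure //.
rewrite -probability_restrict ?undup_uniq //.
apply: le_measure; rewrite ?inE //; first exact: measurable_restrict.
by move=> w; apply: uA => e /andP[].
Qed.

(** Continuity from below along the windows [edges_upto n]. *)
Lemma probability_le_of_finite_prob A c : up_closed A -> finitely_witnessed A ->
  (forall n, finite_prob p (edges_upto n) A <= c) -> fine (P A) <= c.
Proof.
move=> uA fA Ac; have mA := measurable_finitely_witnessed uA fA.
pose An n : set (config G) := [set w | A (restrict (edges_upto n) w)].
have mAn n : measurable (An n) by exact: measurable_restrict.
have AE : A = \bigcup_n An n by exact: up_closed_bigcup_restrict.
have : P (An n) @[n --> \oo] --> P (\bigcup_n An n).
  apply: nondecreasing_cvg_mu => //; first exact: bigcup_measurable.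
  move=> m n mn; apply/subsetPset => w; apply: uA => e /andP[we em].
  by apply/andP; split=> //; exact: sub_edges_upto em.
have <- : P A = P (\bigcup_n An n) by rewrite [in LHS]AE.
move=> cvA; rewrite -lee_fin fineK ?fin_num_measure //.
apply: cvge_le cvA; apply: nearW => n.
rewrite probability_restrict ?undup_uniq // lee_fin; exact: Ac.
Qed.

(** The BK inequality is iterated inside each window. Disjoint occurrences appear only under
    [finite_prob], which is defined on all sets, so measurability concerns [A], [B] and [C]
    alone. *)
Lemma probability_iter_disjoint_occurrence k A B C :
  up_closed A -> finitely_witnessed A -> up_closed B -> finitely_witnessed B ->
  up_closed C -> finitely_witnessed C ->
  C `<=` iter k (disjoint_occurrence A) B ->
  fine (P C) <= fine (P A) ^+ k * fine (P B).
Proof.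
move=> uA fA uB fB uC fC CAB; apply: probability_le_of_finite_prob => // n.
have p01 := edge_probability_itv.
have uI j : up_closed (iter j (disjoint_occurrence A) B).
  by case: j => //= j; exact: up_closed_disjoint_occurrence.
apply: (le_trans (le_finite_prob p01 _ CAB)).
elim: k {CAB} => [|k IH] /=; first by rewrite mul1r finite_prob_le.
apply: (le_trans (van_den_berg_kesten p01 _ uA (uI k))).
by rewrite exprS -mulrA ler_pM ?finite_prob_ge0 ?finite_prob_le.
Qed.

End independent_edges.

(** * Large clusters as disjoint occurrences *)

Section cluster_events.
Context (R : realType) (G : weighted_graph R).
Implicit Types (u v : vertex G) (F : {fset edge G}) (S L : {fset vertex G}).

Definition cluster_event L m u : set (edge G -> bool) :=
  [set w : config G | (m <= cluster_size L w u)%N].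

(** The existential form of [m <= Kmax] inherits monotonicity and finite witnesses from
    [cluster_event]; [max_eventE] identifies the two for non-empty [L]. *)
Definition max_event L m : set (edge G -> bool) :=
  [set w : config G | exists u, (m <= cluster_size L w u)%N].

Lemma cluster_size_mono L (w w' : config G) u : (forall e, w e -> w' e) ->
  (cluster_size L w u <= cluster_size L w' u)%N.
Proof.
move=> ww'; apply: fsubset_leq_card; apply/fsubsetP => x.
rewrite !inE /= => /andP[-> /set_mem h] /=.
by apply/mem_set; exact: cluster_mono h.
Qed.

Lemma card_le_cluster_size L (w : config G) u S :
  (forall x, x \in S -> cluster w u x) ->
  (#|` (S `&` L)%fset| <= cluster_size L w u)%N.
Proof.
move=> h; apply: fsubset_leq_card; apply/fsubsetP => x.
by rewrite !inE /= => /andP[/h xS ->] /=; exact/mem_set.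
Qed.

Lemma cluster_size_rooted_tree L (w : config G) u : exists F S,
  [/\ rooted_tree u F S, forall e, e \in F -> w e &
      (cluster_size L w u <= #|` (S `&` L)%fset|)%N].
Proof.
have [|F [S [T Fw SS]]] :=
  @cluster_rooted_tree _ _ w u [fset x in L | x \in cluster w u]%fset.
  by move=> x; rewrite !inE /= => /andP[_ /set_mem].
exists F, S; split=> //; apply: fsubset_leq_card; apply/fsubsetP => x xC.
rewrite inE (fsubsetP SS _ xC) /=.
by move: xC; rewrite !inE /= => /andP[].
Qed.

Lemma up_closed_cluster_event L m u : up_closed (cluster_event L m u).
Proof. by move=> w w' ww' /leq_trans; apply; exact: cluster_size_mono. Qed.

Lemma up_closed_max_event L m : up_closed (max_event L m).
Proof.
by move=> w w' ww' [u h]; exists u; exact: up_closed_cluster_event ww' h.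
Qed.

Lemma finitely_witnessed_cluster_event L m u :
  finitely_witnessed (cluster_event L m u).
Proof.
move=> w mw; have [F [S [T Fw lS]]] := cluster_size_rooted_tree L w u.
exists F => //; apply: leq_trans mw (leq_trans lS _).
apply: card_le_cluster_size => x; exact: rooted_tree_cluster.
Qed.

Lemma finitely_witnessed_max_event L m : finitely_witnessed (max_event L m).
Proof.
move=> w [u /finitely_witnessed_cluster_event[F Fw h]].
by exists F => //; exists u.
Qed.

(** Each of the [k] cuts yields a piece for [max_event] and costs at most [2 * m] points of [L]; at
    least [m] points remain in the tree that still has root [u]. *)
Lemma rooted_tree_disjoint_occurrence L m k u F S : rooted_tree u F S ->
  (m + 2 * m * k <= #|` (S `&` L)%fset|)%N ->
  iter k (disjoint_occurrence (max_event L m)) (cluster_event L m u)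
    (config_of F).
Proof.
elim: k F S => [|k IH] F S T.
  rewrite muln0 addn0 => h; apply: leq_trans h _.
  by apply: card_le_cluster_size => x; exact: rooted_tree_cluster.
move=> h; have [|v [F1 [S1 [F2 [S2 [T1 T2 F1F F2F [d m1 S2S c]]]]]]] :=
  @rooted_tree_peel _ _ L m u F S T.
  by apply: leq_trans h; exact: leq_addr.
exists (config_of F1), (config_of F2); split.
- exact/fsubsetP.
- exact/fsubsetP.
- by move=> e; apply/negP => /andP[e1]; apply/negP; exact: (fdisjointP d).
- exists v; apply: leq_trans m1 _.
  by apply: card_le_cluster_size => x; exact: rooted_tree_cluster.
- apply: IH T2 _; have : (#|` (S `&` L)%fset| <=
      #|` ((S `\` S2) `&` L)%fset| + #|` (S2 `&` L)%fset|)%N.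
    rewrite -cardfsUI; apply: leq_trans (leq_addr _ _).
    apply: fsubset_leq_card; apply/fsubsetP => x.
    by rewrite !inE; do 3 case: (_ \in _).
  move: c h; rewrite mulnS; lia.
Qed.

Lemma cluster_event_disjoint_occurrence L m k N u : (m + 2 * m * k <= N)%N ->
  cluster_event L N u `<=`
  iter k (disjoint_occurrence (max_event L m)) (cluster_event L m u).
Proof.
move=> mN w Nw; have [F [S [T Fw lS]]] := cluster_size_rooted_tree L w u.
have := rooted_tree_disjoint_occurrence T (leq_trans mN (leq_trans Nw lS)).
case: k {mN} => [|k] /=; first exact: up_closed_cluster_event.
exact: up_closed_disjoint_occurrence.
Qed.

Lemma max_event_disjoint_occurrence L m k N : (m + 2 * m * k <= N)%N ->
  max_event L N `<=`
  iter k (disjoint_occurrence (max_event L m)) (max_event L m).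
Proof.
move=> mN w [u /(cluster_event_disjoint_occurrence mN)].
elim: k w {mN} => [|k IH] w /=; first by exists u.
exact: disjoint_occurrenceS.
Qed.

End cluster_events.

(** [N] is [x] rounded up, or 0 for negative [x]; it turns real thresholds such as [alpha * M] into
    integer ones. *)
Lemma nat_ceilP (R : realType) (x : R) :
  exists N : nat, forall n, (x <= n%:R) = (N <= n)%N.
Proof.
have ex : exists n, x <= n%:R.
  by exists (Num.truncn x).+1; rewrite ltW // truncnS_gt.
case: (ex_minnP ex) => N xN minN; exists N => n.
apply/idP/idP => [/minN//|Nn]; apply: le_trans xN _; by rewrite ler_nat.
Qed.

(** * Tail bounds at the scale of the typical maximum *)

Section tightness.
Context (R : realType) (G : weighted_graph R) (P : probability (config G) R).
Hypothesis indep : mutually_independent P (@edge_retained R G).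
Context (L : {fset vertex G}).
Hypothesis L0 : L != fset0%fset.
Implicit Types (u : vertex G) (w : config G).

Let M := typical_max P L.
Let q m : R := fine (P (max_event L m)).
Let qu u m : R := fine (P (cluster_event L m u)).

Lemma max_eventE m : max_event L m = [set w : config G | (m <= Kmax L w)%N].
Proof.
apply/seteqP; split=> w; have [[v vE] vle] := KmaxP w L0.
  by move=> [u /leq_trans]; apply.
by rewrite /= -vE => mw; exists v.
Qed.

Lemma probability_max_event m : P (max_event L m) = (q m)%:E.
Proof.
rewrite fineK // fin_num_measure //; apply: measurable_finitely_witnessed.
  exact: up_closed_max_event.
exact: finitely_witnessed_max_event.
Qed.

Lemma probability_cluster_event u m : P (cluster_event L m u) = (qu u m)%:E.
Proof.
rewrite fineK // fin_num_measure //; apply: measurable_finitely_witnessed.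
  exact: up_closed_cluster_event.
exact: finitely_witnessed_cluster_event.
Qed.

Lemma max_event_tail m k N : (m + 2 * m * k <= N)%N -> q N <= q m ^+ k.+1.
Proof.
move=> mN; rewrite exprSr; apply: probability_iter_disjoint_occurrence => //;
  try exact: up_closed_max_event; try exact: finitely_witnessed_max_event.
exact: max_event_disjoint_occurrence.
Qed.

Lemma cluster_event_tail u m k N : (m + 2 * m * k <= N)%N ->
  qu u N <= q m ^+ k * qu u m.
Proof.
move=> mN; apply: probability_iter_disjoint_occurrence => //;
  try exact: up_closed_max_event; try exact: finitely_witnessed_max_event;
  try exact: up_closed_cluster_event;
  try exact: finitely_witnessed_cluster_event.
exact: cluster_event_disjoint_occurrence.
Qed.

Lemma max_event_ge0 m : 0 <= q m. Proof. exact: fine_ge0. Qed.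

Lemma cluster_event_ge0 u m : 0 <= qu u m. Proof. exact: fine_ge0. Qed.

Lemma max_event1 : q 1 = 1.
Proof.
rewrite /q (_ : max_event L 1 = setT) ?probability_setT //.
apply/seteqP; split=> // w _; have [v vL] := fset0Pn _ L0.
exists v; rewrite /cluster_size cardfs_gt0; apply/fset0Pn; exists v.
by rewrite !inE vL /=; apply/mem_set; exact: cluster_refl.
Qed.

Lemma max_event_typical_max : q M <= expR (-1).
Proof.
have [small _] := typical_maxP P L0.
by rewrite -lee_fin -probability_max_event max_eventE.
Qed.

Lemma max_event_lt_typical_max n : (n < M)%N -> expR (-1) < q n.
Proof.
have [_ minM] := typical_maxP P L0.
move=> nM; rewrite ltNge; apply: contraL nM => qn; rewrite -leqNgt.
by apply: minM; rewrite -max_eventE probability_max_event lee_fin.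
Qed.

Lemma typical_max_gt0 : (0 < M)%N.
Proof.
have e1 : expR (-1) < 1 :> R by rewrite expR_lt1 oppr_lt0.
rewrite lt0n; apply/negP => /eqP M0.
have := max_event_typical_max; rewrite M0 => q0.
(* With [m = k = 0] the tail bound reads [q 1 <= q 0], but [q 1 = 1] and [q 0 <= expR (-1) < 1]. *)
have := @max_event_tail 0 0 1 isT; rewrite max_event1 expr1; lra.
Qed.

(** Take for [k] the integer part of [(alpha - 1) / 2]. Then [1 + 2 * k <= alpha], while [k + 1] is
    at least 1 and exceeds [(alpha - 1) / 2], which together give [alpha / 9]. *)
Lemma typical_max_pieces (alpha : R) (N : nat) : 1 <= alpha ->
  alpha * M%:R <= N%:R ->
  exists2 k, (M + 2 * M * k <= N)%N & 1 / 9 * alpha <= k.+1%:R.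
Proof.
move=> a1 aN; have a0 : 0 <= (alpha - 1) / 2 by lra.
have := truncn_itv a0; move: (Num.truncn _) => k /andP[k1 k2].
exists k; last first.
  have k0 : 0 <= k%:R :> R by [].
  by move: k2; rewrite -(natr1 k); lra.
rewrite -(ler_nat R) natrD !natrM; apply: le_trans aN.
have M0 : 0 <= M%:R :> R by [].
have : 0 <= (alpha - 1 - 2 * k%:R) * M%:R by rewrite mulr_ge0 //; lra.
lra.
Qed.

Lemma exp_pieces (alpha : R) k : 1 / 9 * alpha <= k.+1%:R ->
  q M ^+ k.+1 <= expR (- (1 / 9 * alpha)).
Proof.
move=> ak; apply: le_trans (_ : expR (-1) ^+ k.+1 <= _).
  by rewrite lerXn2r ?nnegrE ?max_event_ge0 ?expR_ge0 // max_event_typical_max.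
by rewrite -expRM_natl ler_expR mulrN1 lerN2.
Qed.

Lemma max_upper_tail (alpha : R) : 1 <= alpha ->
  (P [set w : config G | (alpha * M%:R <= (Kmax L w)%:R)%R]
     <= (expR (- (1 / 9 * alpha)))%:E)%E.
Proof.
move=> a1; have [N NE] := nat_ceilP (alpha * M%:R).
have [k kN ak] := typical_max_pieces a1 (etrans (NE N) (leqnn N)).
rewrite (_ : [set w | _] = max_event L N); last first.
  by rewrite max_eventE; apply/seteqP; split=> w /=; rewrite NE.
rewrite probability_max_event lee_fin.
exact: le_trans (max_event_tail kN) (exp_pieces ak).
Qed.

(** Only the [k] pieces cut off contribute a factor [1/e], the last one being kept for [u]; the
    prefactor [e] pays for the exponent [k] in place of [k + 1]. *)
Lemma cluster_upper_tail (alpha : R) u : 1 <= alpha ->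
  (P [set w : config G | (alpha * M%:R <= (cluster_size L w u)%:R)%R]
     <= (expR 1)%:E * P [set w : config G | (M <= cluster_size L w u)%N]
        * (expR (- (1 / 9 * alpha)))%:E)%E.
Proof.
move=> a1; have [N NE] := nat_ceilP (alpha * M%:R).
have [k kN ak] := typical_max_pieces a1 (etrans (NE N) (leqnn N)).
rewrite (_ : [set w | _] = cluster_event L N u); last first.
  by apply/seteqP; split=> w /=; rewrite NE.
have -> : P [set w : config G | (M <= cluster_size L w u)%N] = (qu u M)%:E.
  exact: probability_cluster_event.
rewrite probability_cluster_event.
rewrite -!EFinM lee_fin; apply: le_trans (cluster_event_tail u kN) _.
rewrite [leRHS]mulrAC ler_wpM2r ?cluster_event_ge0 // -expRD.
apply: le_trans (_ : expR (-1) ^+ k <= _).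
  by rewrite lerXn2r ?nnegrE ?max_event_ge0 ?expR_ge0 // max_event_typical_max.
by rewrite -expRM_natl ler_expR; move: ak; rewrite -(natr1 k); lra.
Qed.

Lemma max_lower_tail (eps : R) : 0 < eps ->
  (P [set w : config G | ((Kmax L w)%:R < eps * M%:R)%R] <= (27 * eps)%:E)%E.
Proof.
move=> eps0; have [l lE] := nat_ceilP (eps * M%:R).
rewrite (_ : [set w | _] = ~` max_event L l); last first.
  rewrite max_eventE; apply/seteqP; split=> w /=; rewrite ltNge lE.
    by move/negP.
  by move=> ?; apply/negP.
have ml : measurable (max_event L l : set (config G)).
  apply: measurable_finitely_witnessed; first exact: up_closed_max_event.
  exact: finitely_witnessed_max_event.
rewrite probability_setC // probability_max_event -EFinB lee_fin.
have q0 := max_event_ge0 l.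
have [big|small] := leP 1 (27 * eps); first by lra.
have M0 : 0 < M%:R :> R by rewrite ltr0n typical_max_gt0.
have eM0 : 0 < eps * M%:R by exact: mulr_gt0.
have l0 : (0 < l)%N.
  by rewrite lt0n; apply/negP => /eqP l0; move: (lE 0%N); rewrite l0 leNgt eM0.
have lM : l%:R < eps * M%:R + 1.
  have : ~~ (eps * M%:R <= l.-1%:R) by rewrite lE -ltnNge prednK.
  by rewrite -ltNge -[in l%:R](prednK l0) -(natr1 l.-1) ltrD2r.
(* If [eps * M <= 1], then [l = 1] and [q 1 = 1], so the probability is 0. Otherwise rounding up
   costs at most a factor 2, that is, [l < 2 * eps * M]. *)
have [eM1|eM1] := leP (eps * M%:R) 1.
  have -> : l = 1%N by apply/eqP; rewrite eqn_leq l0 -lE eM1.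
  by rewrite max_event1 subrr; lra.
have M27 : 27 < M%:R :> R by nra.
have lM2 : l%:R < 2 * eps * M%:R by lra.
have lM1 : (l <= M.-1)%N.
  rewrite -ltnS prednK ?typical_max_gt0 // -(ltr_nat R).
  by apply: lt_trans lM2 _; nra.
(* [M - 1] is the largest size whose probability still exceeds [1/e]; [k] is the largest number of
   cuts that it allows. *)
have [k kM Mk] : exists2 k,
    (l + 2 * l * k <= M.-1)%N & (M.-1 - l < 2 * l * k.+1)%N.
  exists ((M.-1 - l) %/ (2 * l))%N.
    by rewrite -leq_subRL // mulnC leq_divM.
  by rewrite mulnC ltn_ceil // muln_gt0.
have MkR : M%:R < 1 + l%:R + 2 * l%:R * k.+1%:R :> R.
  have : (M < 1 + l + 2 * l * k.+1)%N.
    by have := typical_max_gt0; move: Mk; rewrite -/M; lia.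
  by rewrite -(ltr_nat R) !natrD !natrM.
have qk : expR (-1) < q l ^+ k.+1.
  apply: lt_le_trans (max_event_tail kM).
  by apply: max_event_lt_typical_max; rewrite prednK ?typical_max_gt0.
(* The bound [q l <= expR (q l - 1)] turns [1/e < q l ^+ k.+1] into a linear inequality. *)
have sx : k.+1%:R * (1 - q l) < 1.
  have : expR (-1) < expR (k.+1%:R * (q l - 1)).
    apply: lt_le_trans qk _; rewrite expRM_natl lerXn2r ?nnegrE ?expR_ge0 //.
    by have := expR_ge1Dx (q l - 1); lra.
  by rewrite ltr_expR; lra.
(* Suppose [27 * eps < 1 - q l], so that [27 * eps * k.+1 < 1]. Eliminating [k] by [MkR], [l] by
   [lM2] and [eps] by [27 * eps < 1] leaves [21 * M < 27], against [M27]. *)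
rewrite leNgt; apply/negP => contra.
have s0 : 0 < k.+1%:R :> R by [].
have s1 : 27 * eps * k.+1%:R < 1.
  by apply: le_lt_trans sx; rewrite mulrC ler_pM2l // ltW.
have lR : 0 < l%:R :> R by rewrite ltr0n.
have h1 : 27 * eps * (M%:R - 1 - l%:R) < 2 * l%:R.
  have h2 : 27 * eps * (M%:R - 1 - l%:R) < 27 * eps * (2 * l%:R * k.+1%:R).
    by rewrite ltr_pM2l; lra.
  have h3 : 2 * l%:R * (27 * eps * k.+1%:R) < 2 * l%:R * 1.
    by rewrite ltr_pM2l //; lra.
  lra.
have h4 : 27 * eps * (M%:R - 1 - 2 * eps * M%:R) < 4 * eps * M%:R.
  have : 27 * eps * (M%:R - 1 - 2 * eps * M%:R) < 27 * eps * (M%:R - 1 - l%:R).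
    by rewrite ltr_pM2l; lra.
  lra.
have h5 : eps * (27 * (M%:R - 1 - 2 * eps * M%:R) - 4 * M%:R) < 0 by lra.
move: h5; rewrite pmulr_rlt0 //; apply/negP; rewrite -leNgt.
have : (27 * eps) * M%:R < 1 * M%:R by rewrite ltr_pM2r.
lra.
Qed.

End tightness.

Theorem theorem2p2 (R : realType) (G : weighted_graph R)
    (L : {fset vertex G}) (hL : L != fset0%fset)
    (beta : R) (hbeta : 0 <= beta)
    (P : probability (config G) R) (hP : bernoulli_percolation beta P) :
  (forall alpha : R, 1 <= alpha ->
    (P [set w : config G |
          (alpha * (typical_max P L)%:R <= (Kmax L w)%:R)%R]
     <= (expR (- (1 / 9 * alpha)))%:E)%E) /\
  (forall eps : R, 0 < eps -> eps <= 1 ->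
    (P [set w : config G |
          ((Kmax L w)%:R < eps * (typical_max P L)%:R)%R]
     <= (27 * eps)%:E)%E) /\
  (forall (alpha : R) (u : vertex G), 1 <= alpha ->
    (P [set w : config G |
          (alpha * (typical_max P L)%:R <= (cluster_size L w u)%:R)%R]
     <= (expR 1)%:E
        * P [set w : config G | (typical_max P L <= cluster_size L w u)%N]
        * (expR (- (1 / 9 * alpha)))%:E)%E).
Proof.
have [indep _] := hP; split; first exact: max_upper_tail.
split; first by move=> eps eps0 _; exact: max_lower_tail.
by move=> alpha u; exact: cluster_upper_tail.
Qed.
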